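(* Let $n$ be odd, and let $C$ and $D$ be concentric ellipses in $\mathbb R^2$ with $D$ inside $C$. Let $P=(p_1,\dots,p_n)$ be a Poncelet $n$-gon for the pair $(C,D)$, and let $Q$ be the polygon whose $i$-th vertex is the intersection of the tangent lines to $C$ at $p_i$ and $p_{i+1}$. Then the ratio $\operatorname{Area}(Q)/\operatorname{Area}(P)$ is the same for all polygons $P$ in the Poncelet family containing $P$.
   Context: A Poncelet $n$-gon for the pair $(C,D)$ is a closed polygon $(p_1,\dots,p_n)$ (indices mod $n$) with all vertices on $C$ and all sides $p_ip_{i+1}$ tangent to $D$. By the Poncelet porism, if one such closed $n$-gon exists, then starting from any point of $C$ and successively drawing tangent lines to $D$ (always continuing in the same rotational sense) produces a closed $n$-gon; the Poncelet family is this continuous 1-parameter family of polygons. For self-intersecting polygons, area means the signed area given by the shoelace formula. *)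

(* Defs.v *)
(* plane geometry over an arbitrary real closed field R
   (the statement is purely algebraic/order-theoretic). *)
From HB Require Import structures.
From mathcomp Require Import all_boot all_order all_algebra.
Set Implicit Arguments. Unset Strict Implicit. Unset Printing Implicit Defensive.
Import Order.TTheory GRing.Theory Num.Theory.
Local Open Scope ring_scope.

Section Geom.
Variable R : rcfType.

Definition pt := (R * R)%type.
Definition psub (u v : pt) : pt := (u.1 - v.1, u.2 - v.2).
Definition cross (u v : pt) : R := u.1 * v.2 - u.2 * v.1.

(* An ellipse {x | a X^2 + 2 b X Y + d Y^2 = 1, (X,Y) = x - c}. *)
Record ellipse := Ellipse { ctr : pt; ea : R; eb : R; ed : R }.

Definition is_ellipse (E : ellipse) : Prop :=
  0 < ea E /\ 0 < ea E * ed E - eb E ^+ 2.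

Definition qf (E : ellipse) (v : pt) : R :=
  ea E * v.1 ^+ 2 + 2%:R * eb E * v.1 * v.2 + ed E * v.2 ^+ 2.
Definition bil (E : ellipse) (u v : pt) : R :=
  ea E * u.1 * v.1 + eb E * (u.1 * v.2 + u.2 * v.1) + ed E * u.2 * v.2.

Definition on_ellipse (E : ellipse) (x : pt) : Prop := qf E (psub x (ctr E)) = 1.
Definition strictly_inside (E : ellipse) (x : pt) : Prop := qf E (psub x (ctr E)) < 1.

Definition on_line (p q x : pt) : Prop := cross (psub q p) (psub x p) = 0.

Definition line_tangent (E : ellipse) (p q : pt) : Prop :=
  p <> q /\
  (exists x, on_line p q x /\ on_ellipse E x) /\
  (forall x y, on_line p q x -> on_ellipse E x ->
               on_line p q y -> on_ellipse E y -> x = y).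

(* x lies on the tangent line to E at the point p of E
   (the polar line  B(p - c, x - c) = 1) *)
Definition on_tangent_at (E : ellipse) (p x : pt) : Prop :=
  bil E (psub p (ctr E)) (psub x (ctr E)) = 1.

(* polygons: n-periodic vertex lists, indices taken mod n *)
Definition nxt (n i : nat) : nat := (i.+1 %% n)%N.

(* signed area by the shoelace formula *)
Definition area (n : nat) (p : nat -> pt) : R :=
  2%:R^-1 * \sum_(i < n) cross (p i) (p (nxt n i)).

(* (p_0,...,p_{n-1}) is a Poncelet n-gon for (C,D) traversed in the
   rotational sense s (s = 1: counterclockwise, s = -1: clockwise)
   around the common centre c of C and D. *)
Definition poncelet_ngon_sense (C D : ellipse) (n : nat) (s : R)
    (p : nat -> pt) : Prop :=
  forall i, (i < n)%N ->
    [/\ on_ellipse C (p i),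
        line_tangent D (p i) (p (nxt n i)) &
        0 < s * cross (psub (p i) (ctr D)) (psub (p (nxt n i)) (ctr D))].

Definition tangential_polygon (C : ellipse) (n : nat) (p q : nat -> pt) : Prop :=
  forall i, (i < n)%N ->
    on_tangent_at C (p i) (q i) /\ on_tangent_at C (p (nxt n i)) (q i).

End Geom.

(* Main.v *)
Require Import Defs.
From HB Require Import structures.
From mathcomp Require Import all_boot all_order all_algebra.
From mathcomp Require Import ring lra.
Import Order.TTheory GRing.Theory Num.Theory.
Local Open Scope ring_scope.

(* Take coordinates in which C is the unit circle and D = {x : |L x| = 1} with L symmetric, L > 1.
   If q is the pole of the side p p' of P, tangency of p p' to D says exactly that m = L^-1 q is a
   unit vector, and <L p, m> = <L m, p'> = 1.  So p -> m -> p' are two steps of one and the same map,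
   a square root of the Poncelet map, which commutes with -1 and preserves the orientation of pairs of
   points.  Let z be its orbit, containing the p_i and the m_i alternately and of period 2n: cross(z_0, z_n)
   cannot be positive, since applying the map n times would give cross(z_n, z_0) > 0, and likewise it cannot be negative.
   Hence z_(j+n) = +-z_j, and as n is odd the polygon (m_i) is P or -P with shifted indices.
   Therefore Area(Q) = det L * Area(P), that is, the ratio is Area(C) / Area(D). *)

Section Plane.
Variable R : rcfType.
Implicit Types u v p q m : pt R.

(** * Simultaneous normal form of two concentric ellipses *)

Definition dot u v : R := u.1 * v.1 + u.2 * v.2.
Definition symm (l1 l2 l3 : R) u : pt R := (l1 * u.1 + l2 * u.2, l2 * u.1 + l3 * u.2).
Definition upper (w1 w2 w3 : R) u : pt R := (w1 * u.1 + w2 * u.2, w3 * u.2).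

Lemma qfE (E : ellipse R) v : qf E v = bil E v v.
Proof. by rewrite /qf /bil; ring. Qed.

(** Cholesky factorization: [upper w1 w2 w3] turns the form into the squared norm. *)
Lemma posdef_upper (a b d : R) : 0 < a -> 0 < a * d - b ^+ 2 ->
  exists w1 w2 w3, [/\ 0 < w1, 0 < w3, w1 ^+ 2 = a, w1 * w2 = b & w2 ^+ 2 + w3 ^+ 2 = d].
Proof.
move=> a_gt0 D_gt0; have w1_gt0 : 0 < Num.sqrt a by rewrite sqrtr_gt0.
have w3_gt0 : 0 < (a * d - b ^+ 2) / a by rewrite divr_gt0.
exists (Num.sqrt a), (b / Num.sqrt a), (Num.sqrt ((a * d - b ^+ 2) / a)).
have sqa : Num.sqrt a ^+ 2 = a by rewrite sqr_sqrtr // ltW.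
have a_neq0 := lt0r_neq0 a_gt0.
split=> //; rewrite ?sqrtr_gt0 //; first by rewrite mulrCA divff ?mulr1 ?lt0r_neq0.
rewrite sqr_sqrtr ?ltW // expr_div_n sqa; field.
exact: a_neq0.
Qed.

(* By Cayley-Hamilton, the square root of a positive 2x2 matrix [H] is [(H + r) / t], where
   [r ^+ 2 = \det H] and [t ^+ 2 = \tr H + 2 r]. *)
Lemma posdef_sqrt (h1 h2 h3 : R) : 0 < h1 -> 0 < h1 * h3 - h2 ^+ 2 ->
  exists l1 l2 l3, [/\ 0 < l1 + l3, 0 < l1 * l3 - l2 ^+ 2,
    l1 ^+ 2 + l2 ^+ 2 = h1, l2 * (l1 + l3) = h2 & l2 ^+ 2 + l3 ^+ 2 = h3].
Proof.
move=> h1_gt0 D_gt0; have h3_gt0 : 0 < h3.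
  have : 0 < h1 * h3 by have := sqr_ge0 h2; lra.
  by rewrite pmulr_rgt0.
have [r [r_gt0 r2]] : exists r, 0 < r /\ r ^+ 2 = h1 * h3 - h2 ^+ 2.
  by exists (Num.sqrt (h1 * h3 - h2 ^+ 2)); rewrite sqrtr_gt0 sqr_sqrtr ?ltW.
have T_gt0 : 0 < h1 + h3 + r *+ 2 by lra.
have [t [t_gt0 t2]] : exists t, 0 < t /\ t ^+ 2 = h1 + h3 + r *+ 2.
  by exists (Num.sqrt (h1 + h3 + r *+ 2)); rewrite sqrtr_gt0 sqr_sqrtr ?ltW.
have t_neq0 := lt0r_neq0 t_gt0.
have h3E : h3 = t ^+ 2 - h1 - r *+ 2 by rewrite t2; ring.
have h2E : h2 ^+ 2 = h1 * (t ^+ 2 - h1 - r *+ 2) - r ^+ 2 by rewrite r2 h3E; ring.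
exists ((h1 + r) / t), (h2 / t), ((h3 + r) / t).
have trE : (h1 + r) / t + (h3 + r) / t = t by rewrite h3E; field.
rewrite trE; split=> //.
- suff -> : (h1 + r) / t * ((h3 + r) / t) - (h2 / t) ^+ 2 = r by [].
  by rewrite expr_div_n h2E h3E; field.
- by rewrite !expr_div_n h2E; field.
- by rewrite divfK.
- by rewrite !expr_div_n h2E h3E; field.
Qed.

Lemma normal_form (C D : ellipse R) : is_ellipse C -> is_ellipse D ->
  (forall v, qf D v = 1 -> qf C v < 1) ->
  exists w1 w2 w3 l1 l2 l3,
    [/\ 0 < w1 * w3, 0 < l1 + l3, 0 < l1 * l3 - l2 ^+ 2 & 0 < (l1 - 1) * (l3 - 1) - l2 ^+ 2] /\
    (forall u v, bil C u v = dot (upper w1 w2 w3 u) (upper w1 w2 w3 v)) /\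
    (forall u v, bil D u v = dot (symm l1 l2 l3 (upper w1 w2 w3 u)) (symm l1 l2 l3 (upper w1 w2 w3 v))).
Proof.
case: C D => cC a b d [cD a' b' d'] [/= a_gt0 dC_gt0] [/= a'_gt0 dD_gt0].
rewrite /qf /bil /= => inside.
have [w1 [w2 [w3 [w1_gt0 w3_gt0 Ea Eb Ed]]]] := posdef_upper _ _ _ a_gt0 dC_gt0.
have w1_neq0 := lt0r_neq0 w1_gt0; have w3_neq0 := lt0r_neq0 w3_gt0.
(* [h1], [h2], [h3] are the entries of the matrix H of [D] in the coordinates that make [C] the unit
   circle. *)
pose h1 := a' / w1 ^+ 2; pose h2 := (b' - h1 * w1 * w2) / (w1 * w3).
pose h3 := (d' - h1 * w2 ^+ 2 - 2 * h2 * w2 * w3) / w3 ^+ 2.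
have Ea' : h1 * w1 ^+ 2 = a' by rewrite /h1; field.
have Eb' : h1 * w1 * w2 + h2 * w1 * w3 = b' by rewrite /h2; field; rewrite w3_neq0 w1_neq0.
have Ed' : h1 * w2 ^+ 2 + 2 * h2 * w2 * w3 + h3 * w3 ^+ 2 = d' by rewrite /h3; field.
have h1_gt0 : 0 < h1 by rewrite /h1 divr_gt0 ?exprn_gt0.
have dh_gt0 : 0 < h1 * h3 - h2 ^+ 2.
  have : 0 < (w1 * w3) ^+ 2 * (h1 * h3 - h2 ^+ 2).
    by move: dD_gt0; congr (0 < _); rewrite -Ea' -Eb' -Ed'; ring.
  by rewrite pmulr_rgt0 // exprn_gt0 // mulr_gt0.
(* H exceeds the identity: dividing a vector by the root [r] of its H-value puts it on [D], hence
   inside [C]. *)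
have above (y1 y2 : R) : (y1, y2) != 0 ->
    y1 ^+ 2 + y2 ^+ 2 < h1 * y1 ^+ 2 + 2 * h2 * y1 * y2 + h3 * y2 ^+ 2.
  move=> y_neq0; set H := ltRHS.
  have H_gt0 : 0 < H.
    have HE : h1 * H = (h1 * y1 + h2 * y2) ^+ 2 + (h1 * h3 - h2 ^+ 2) * y2 ^+ 2 by rewrite /H; ring.
    rewrite -(pmulr_rgt0 _ h1_gt0) HE.
    have [y20|y2_neq0] := eqVneq y2 0.
      rewrite y20 in y_neq0 *; rewrite mulr0 addr0 expr0n mulr0 addr0.
      rewrite lt0r sqr_ge0 sqrf_eq0 mulf_neq0 //; first exact: lt0r_neq0.
      by move: y_neq0; rewrite xpair_eqE eqxx andbT.
    by rewrite ltr_wpDl ?sqr_ge0 // mulr_gt0 // lt0r sqr_ge0 sqrf_eq0 y2_neq0.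
  pose r := Num.sqrt H; have r2 : r ^+ 2 = H by rewrite sqr_sqrtr // ltW.
  have r_neq0 : r != 0 by rewrite lt0r_neq0 // sqrtr_gt0.
  have := inside ((y1 - w2 * y2 / w3) / w1 / r, y2 / w3 / r) => /=.
  have -> : a' * ((y1 - w2 * y2 / w3) / w1 / r) ^+ 2
      + 2 * b' * ((y1 - w2 * y2 / w3) / w1 / r) * (y2 / w3 / r) + d' * (y2 / w3 / r) ^+ 2
      = H / r ^+ 2.
    by rewrite -Ea' -Eb' -Ed' /H; field; rewrite ?r_neq0 ?w1_neq0 ?w3_neq0.
  have -> : a * ((y1 - w2 * y2 / w3) / w1 / r) ^+ 2
      + 2 * b * ((y1 - w2 * y2 / w3) / w1 / r) * (y2 / w3 / r) + d * (y2 / w3 / r) ^+ 2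
      = (y1 ^+ 2 + y2 ^+ 2) / r ^+ 2.
    by rewrite -Ea -Eb -Ed; field; rewrite ?r_neq0 ?w1_neq0 ?w3_neq0.
  by rewrite r2 divff ?lt0r_neq0 // => /(_ erefl); rewrite ltr_pdivrMr // mul1r.
have [l1 [l2 [l3 [tr_gt0 det_gt0 E1 E2 E3]]]] := posdef_sqrt _ _ _ h1_gt0 dh_gt0.
exists w1, w2, w3, l1, l2, l3; split; first split=> //; first exact: mulr_gt0.
  have h11 : 0 < h1 - 1.
    have := above 1 0; rewrite xpair_eqE oner_eq0 => /(_ isT); lra.
  have : 0 < (h1 - 1) * ((h1 - 1) * (h3 - 1) - h2 ^+ 2).
    (* At this vector the form [H - 1] takes the value [(h1 - 1) * det (H - 1)]. *)
    have := above (- h2) (h1 - 1); rewrite xpair_eqE (negPf (lt0r_neq0 h11)) andbF => /(_ isT).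
    nra.
  rewrite pmulr_rgt0 //.
  (* Since [H = L ^ 2], [det (H - 1)] factors as [det (L + 1) * det (L - 1)]. *)
  have -> : (h1 - 1) * (h3 - 1) - h2 ^+ 2 =
      (l1 * l3 - l2 ^+ 2 + (l1 + l3) + 1) * ((l1 - 1) * (l3 - 1) - l2 ^+ 2).
    by rewrite -E1 -E2 -E3; ring.
  by rewrite pmulr_rgt0 //; lra.
split=> u v; rewrite /dot /symm /upper /=.
  by rewrite -Ea -Eb -Ed; ring.
by rewrite -Ea' -Eb' -Ed' -E1 -E2 -E3; ring.
Qed.

(** * The half step on the unit circle *)

Section HalfStep.
Variables (l1 l2 l3 s : R).
Hypotheses (tr_gt0 : 0 < l1 + l3) (det1_gt0 : 0 < (l1 - 1) * (l3 - 1) - l2 ^+ 2).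
Hypothesis sqr_s : s ^+ 2 = 1.
Let L := symm l1 l2 l3.

(** For given [u] the line [dot (L u) v = 1] meets the circle in at most two points; the sense [s]
    of the turn selects one. *)
Definition half_step u v :=
  [/\ dot u u = 1, dot v v = 1, dot (L u) v = 1 & 0 < s * cross u v].

Lemma dot_symm u v : dot (L u) v = dot u (L v).
Proof. by rewrite /dot /L /symm /=; ring. Qed.

Lemma unit_frame u v : dot v v = 1 ->
  u = (dot u v * v.1 + cross u v * v.2, dot u v * v.2 - cross u v * v.1).
Proof.
case: u v => u1 u2 [v1 v2]; rewrite /dot /cross /= => vv.
by congr pair; rewrite -[LHS]mulr1 -vv; ring.
Qed.

Lemma half_step_sum u v : cross (L u) v + cross u (L v) = (l1 + l3) * cross u v.
Proof. by rewrite /cross /L /symm /=; ring. Qed.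

(** Being at least [det (L - 1) > 0], the product forces its factors to share a sign, which by
    [half_step_sum] is that of [cross u v]. *)
Lemma half_step_prod u v : dot u u = 1 -> dot v v = 1 -> dot (L u) v = 1 ->
  cross (L u) v * cross u (L v) = (l1 - 1) * (l3 - 1) - l2 ^+ 2 + (l1 + l3) * (1 - dot u v).
Proof.
move=> uu vv uv.
have -> : cross (L u) v * cross u (L v) =
    (l1 * l3 - l2 ^+ 2) * (dot u u * dot v v) + dot (L u) v ^+ 2 - (l1 + l3) * (dot (L u) v * dot u v).
  by rewrite /cross /dot /L /symm /=; ring.
by rewrite uu vv uv; ring.
Qed.

Lemma dot_unit_le1 u v : dot u u = 1 -> dot v v = 1 -> dot u v <= 1.
Proof.
move=> uu vv; have : 0 <= dot (psub u v) (psub u v).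
  by rewrite addr_ge0 // -expr2 sqr_ge0.
suff -> : dot (psub u v) (psub u v) = dot u u + dot v v - 2 * dot u v by rewrite uu vv; lra.
by rewrite /dot /psub /=; ring.
Qed.

Lemma half_step_prod_gt0 u v : dot u u = 1 -> dot v v = 1 -> dot (L u) v = 1 ->
  0 < cross (L u) v * cross u (L v).
Proof.
move=> uu vv uv; rewrite half_step_prod // ltr_wpDr //.
by rewrite mulr_ge0 ?subr_ge0 ?dot_unit_le1 // ltW.
Qed.

Lemma same_sign (x y : R) : 0 < x * y -> (0 < s * x) = (0 < s * y).
Proof.
move=> xy; have : 0 < (s * x) * (s * y).
  by have -> : (s * x) * (s * y) = s ^+ 2 * (x * y); [ring | rewrite sqr_s mul1r].
by move=> sxy; apply/idP/idP => ?; [rewrite -(pmulr_rgt0 _ (x := s * x)) | rewrite -(pmulr_lgt0 _ (x := s * y))].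
Qed.

Lemma half_step_speed u v : half_step u v -> 0 < s * cross (L u) v /\ 0 < s * cross u (L v).
Proof.
move=> [uu vv uv]; have E := same_sign _ _ (half_step_prod_gt0 _ _ uu vv uv).
have : s * cross (L u) v + s * cross u (L v) = (l1 + l3) * (s * cross u v).
  by rewrite -mulrDr half_step_sum; ring.
move=> S; rewrite -(pmulr_rgt0 _ tr_gt0) -S.
by case: (ltrP 0 (s * cross (L u) v)) E => [|] ? E; split; lra.
Qed.

(* A discrete derivative of the half step: compare [dot (L u) v'] with [dot u (L v')], and [dot (L u') v]
   with [dot u' (L v)], writing each image under [L] in the orthonormal frame of its partner. *)
Lemma half_step_cross u v u' v' : half_step u v -> half_step u' v' ->
  (cross (L u) v + cross (L u') v') * cross v v' =
  (cross u (L v) + cross u' (L v')) * cross u u'.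
Proof.
move=> [uu vv uv _] [uu' vv' uv' _].
have vu : dot (L v) u = 1 by rewrite -uv dot_symm /dot; ring.
have vu' : dot (L v') u' = 1 by rewrite -uv' dot_symm /dot; ring.
have E1 := dot_symm u v'; have E2 := dot_symm u' v.
rewrite (unit_frame (L u) _ vv) (unit_frame (L v') _ uu') uv vu' in E1.
rewrite (unit_frame (L u') _ vv') (unit_frame (L v) _ uu) uv' vu in E2.
move: E1 E2.
have -> : cross (L v) u = - cross u (L v) by rewrite /cross; ring.
have -> : cross (L v') u' = - cross u' (L v') by rewrite /cross; ring.
move: (cross (L u) v) (cross u (L v)) (cross (L u') v') (cross u' (L v')) => a b a' b'.
by rewrite /dot /cross /=; lra.
Qed.

(** Both coefficients in [half_step_cross] have the sign [s]. *)
Lemma half_step_mono u v u' v' : half_step u v -> half_step u' v' ->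
  0 < cross u u' -> 0 < cross v v'.
Proof.
move=> uv uv'; have := half_step_cross _ _ _ _ uv uv'.
have [a b] := half_step_speed _ _ uv; have [a' b'] := half_step_speed _ _ uv'.
move=> E c; rewrite -(pmulr_rgt0 _ (addr_gt0 a a')).
suff -> : (s * cross (L u) v + s * cross (L u') v') * cross v v' =
    (s * cross u (L v) + s * cross u' (L v')) * cross u u' by rewrite mulr_gt0 // addr_gt0.
by rewrite -!mulrDr -!mulrA E.
Qed.

(** * Orbits of period [2n] *)

Lemma half_step_antiperiod (z : nat -> pt R) n :
  (forall j, half_step (z j) (z j.+1)) -> (forall j, z (j + n + n)%N = z j) ->
  forall j, cross (z j) (z (j + n)%N) = 0.
Proof.
move=> zS per j; pose x i := cross (z i) (z (i + n)%N).
have xn i : x (i + n)%N = - x i by rewrite /x per /cross; ring.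
have up i k : 0 < x i -> 0 < x (i + k)%N.
  move=> xi; elim: k => [|k IHk]; rewrite ?addn0 // addnS /x addSn.
  exact: half_step_mono (zS _) (zS _) IHk.
have [x_gt0|x_lt0|//] := ltgtP 0 (x j).
  by have := up j n x_gt0; rewrite xn; lra.
have : 0 < x (j + n)%N by rewrite xn; lra.
by move=> /up => /(_ n); rewrite !xn; lra.
Qed.

(** Antiperiodicity gives [z (j + n) = e j * z j] with a sign [e j]; the step equation at [j + n]
    yields [e j * e j.+1 = 1], so [e j.+2 = e j] and the signs cancel in the cross product. *)
Lemma half_step_cross_shift (z : nat -> pt R) n :
  (forall j, half_step (z j) (z j.+1)) -> (forall j, z (j + n + n)%N = z j) ->
  forall j, cross (z (j + n)%N) (z (j.+2 + n)%N) = cross (z j) (z j.+2).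
Proof.
move=> zS per.
pose e j := dot (z (j + n)%N) (z j).
have zE j : z (j + n)%N = (e j * (z j).1, e j * (z j).2).
  have [zz _ _ _] := zS j.
  have c0 : cross (z (j + n)%N) (z j) = 0.
    by rewrite -[RHS]oppr0 -(half_step_antiperiod _ _ zS per j) /cross; ring.
  by rewrite [LHS](unit_frame _ (z j) zz) c0 !mul0r addr0 subr0.
have eS j : e j * e j.+1 = 1.
  have [_ _ uv _] := zS j; have [_ _] := zS (j + n)%N.
  rewrite -addSn !zE => + _ => <-; rewrite -[LHS]mulr1 -uv.
  by rewrite /dot /L /symm /=; ring.
move=> j; rewrite !zE.
have -> : e j.+2 = e j.
  by rewrite -[LHS]mul1r -(eS j) -mulrA eS mulr1.
have ee : e j ^+ 2 = 1.
  have [zz _ _ _] := zS j; have [+ _ _ _] := zS (j + n)%N.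
  by rewrite zE => <-; rewrite -[LHS]mulr1 -zz /dot /=; ring.
by rewrite -[RHS]mul1r -ee /cross /=; ring.
Qed.

(** * From tangent chords to pairs of half steps *)

Hypothesis det_neq0 : l1 * l3 - l2 ^+ 2 != 0.
Definition symm_inv u : pt R :=
  ((l3 * u.1 - l2 * u.2) / (l1 * l3 - l2 ^+ 2), (l1 * u.2 - l2 * u.1) / (l1 * l3 - l2 ^+ 2)).

Lemma symm_invK u : L (symm_inv u) = u.
Proof. by case: u => u1 u2; congr pair => /=; field. Qed.

(** Here [q] is the pole of the chord [u v], and the last hypothesis says that the line through
    [L u] and [L v] has distance 1 from the origin. *)
Lemma tangent_half_steps u v q :
  dot u u = 1 -> dot v v = 1 -> 0 < s * cross u v -> dot u q = 1 -> dot v q = 1 ->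
  dot (L (psub v u)) (L (psub v u)) = ((l1 * l3 - l2 ^+ 2) * cross u v) ^+ 2 ->
  half_step u (symm_inv q) /\ half_step (symm_inv q) v.
Proof.
move=> uu vv S_gt0 uq vq tang.
have S_neq0 : cross u v != 0 by apply: contraTneq S_gt0 => ->; rewrite mulr0 ltxx.
have Sq1 : cross u v * q.1 = v.2 - u.2.
  transitivity (dot u q * v.2 - dot v q * u.2); last by rewrite uq vq !mul1r.
  by rewrite /cross /dot; ring.
have Sq2 : cross u v * q.2 = u.1 - v.1.
  transitivity (dot v q * u.1 - dot u q * v.1); last by rewrite uq vq !mul1r.
  by rewrite /cross /dot; ring.
(* By Cramer's rule [cross u v] times [q] is [v - u] turned by a right angle. The same turn
   conjugates [L] into its adjugate, so [tang] becomes the unit length of [symm_inv q]. *)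
have mm : dot (symm_inv q) (symm_inv q) = 1.
  have X_neq0 : ((l1 * l3 - l2 ^+ 2) * cross u v) ^+ 2 != 0 by rewrite expf_neq0 // mulf_neq0.
  apply: (mulfI X_neq0); rewrite mulr1 -[RHS]tang.
  transitivity ((l3 * (cross u v * q.1) - l2 * (cross u v * q.2)) ^+ 2
    + (l1 * (cross u v * q.2) - l2 * (cross u v * q.1)) ^+ 2).
    by rewrite /symm_inv /dot /=; field.
  by rewrite Sq1 Sq2 /dot /L /symm /psub /=; ring.
have um : dot (L u) (symm_inv q) = 1 by rewrite dot_symm symm_invK.
have mv : dot (L (symm_inv q)) v = 1 by rewrite symm_invK -vq /dot; ring.
have c_lt1 : dot u v < 1.
  rewrite lt_neqAle dot_unit_le1 // andbT; apply: contraNneq S_neq0 => c1.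
  rewrite -sqrf_eq0; have -> : cross u v ^+ 2 = dot u u * dot v v - dot u v ^+ 2.
    by rewrite /cross /dot; ring.
  by rewrite uu vv c1; apply/eqP; ring.
(* [cross u q] and [cross q v], multiplied by [cross u v], both become [1 - dot u v]. *)
have uq_gt0 : 0 < s * cross u q.
  rewrite (same_sign _ (cross u v)) //.
  have -> : cross u q * cross u v = u.1 * (cross u v * q.2) - u.2 * (cross u v * q.1).
    by rewrite [cross u q]/cross; ring.
  by rewrite Sq1 Sq2; move: uu c_lt1; rewrite /dot; lra.
have qv_gt0 : 0 < s * cross q v.
  rewrite (same_sign _ (cross u v)) //.
  have -> : cross q v * cross u v = (cross u v * q.1) * v.2 - (cross u v * q.2) * v.1.
    by rewrite [cross q v]/cross; ring.
  by rewrite Sq1 Sq2; move: vv c_lt1; rewrite /dot; lra.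
(* The sign passes from [cross u q = cross u (L m)] to [cross (L u) m], where [m = symm_inv q], and
   then to their sum, a positive multiple of [cross u m]; likewise for [m] and [v]. *)
split; split=> //; rewrite -(pmulr_rgt0 _ tr_gt0).
- have : 0 < s * cross (L u) (symm_inv q).
    by rewrite (same_sign _ _ (half_step_prod_gt0 _ _ uu mm um)) symm_invK.
  have := half_step_sum u (symm_inv q); rewrite symm_invK => E1 E2.
  by rewrite mulrCA -E1 mulrDr addr_gt0.
- have : 0 < s * cross (symm_inv q) (L v).
    by rewrite -(same_sign _ _ (half_step_prod_gt0 _ _ mm vv mv)) symm_invK.
  have := half_step_sum (symm_inv q) v; rewrite symm_invK => E1 E2.
  by rewrite mulrCA -E1 mulrDr addr_gt0.
Qed.

End HalfStep.

(** * Tangency as a vanishing discriminant *)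

Lemma line_tangent_discr (D : ellipse R) p q : is_ellipse D -> line_tangent D p q ->
  let u := psub p (ctr D) in let d := psub q p in
  bil D u d ^+ 2 = qf D d * (qf D u - 1).
Proof.
case: D p q => [[c1 c2] a b d] [p1 p2] [q1 q2] [/= a_gt0 det_gt0] [pq [[[x1 x2] [xL xD]] uniq]] /=.
move: xL xD uniq; rewrite /on_line /on_ellipse /qf /bil /cross /psub /=.
set d1 := q1 - p1; set d2 := q2 - p2; set u1 := p1 - c1; set u2 := p2 - c2.
(* On the line, [D] is given by [A * r ^+ 2 + 2 * B * r + E = 1]; tangency will force a double
   root. *)
set A := a * d1 ^+ 2 + _ + _; set B := _ + d * u2 * d2; set E := a * u1 ^+ 2 + _ + _.
move=> xL xD uniq.
have A_neq0 : A != 0.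
  have AE : a * A = (a * d1 + b * d2) ^+ 2 + (a * d - b ^+ 2) * d2 ^+ 2 by rewrite /A; ring.
  have aA : a * A = 0 -> (q1, q2) = (p1, p2).
    move/eqP; rewrite AE paddr_eq0 ?sqr_ge0 ?(mulr_ge0 (ltW det_gt0)) ?sqr_ge0 //.
    rewrite sqrf_eq0 mulf_eq0 (gt_eqF det_gt0) sqrf_eq0 /= => /andP[+ /eqP d20].
    rewrite d20 mulr0 addr0 mulf_eq0 (gt_eqF a_gt0) /= => /eqP d10.
    by congr pair; apply/eqP; rewrite -subr_eq0; apply/eqP.
  by apply: contra_not_neq pq => A0; rewrite aA // A0 mulr0.
have d_neq0 : d1 ^+ 2 + d2 ^+ 2 != 0.
  apply: contraNneq A_neq0 => /eqP; rewrite paddr_eq0 ?sqr_ge0 // !sqrf_eq0 => /andP[/eqP d10 /eqP d20].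
  by rewrite /A d10 d20; apply/eqP; ring.
(* Orthogonal projection yields the parameter of the contact point without dividing by a coordinate
   of the direction. *)
pose t := ((x1 - p1) * d1 + (x2 - p2) * d2) / (d1 ^+ 2 + d2 ^+ 2).
have x1E : x1 = p1 + t * d1.
  transitivity (p1 + t * d1 - d2 * (d1 * (x2 - p2) - d2 * (x1 - p1)) / (d1 ^+ 2 + d2 ^+ 2)).
    by rewrite /t; field.
  by rewrite xL mulr0 mul0r subr0.
have x2E : x2 = p2 + t * d2.
  transitivity (p2 + t * d2 + d1 * (d1 * (x2 - p2) - d2 * (x1 - p1)) / (d1 ^+ 2 + d2 ^+ 2)).
    by rewrite /t; field.
  by rewrite xL mulr0 mul0r addr0.
have onD r : a * (p1 + r * d1 - c1) ^+ 2 + 2 * b * (p1 + r * d1 - c1) * (p2 + r * d2 - c2)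
    + d * (p2 + r * d2 - c2) ^+ 2 = A * r ^+ 2 + 2 * B * r + E.
  by rewrite /A /B /E /u1 /u2; ring.
have rootE : A * t ^+ 2 + 2 * B * t + E = 1 by rewrite -onD -x1E -x2E.
(* The other root, by Vieta; uniqueness of the contact point gives [t = t']. *)
pose t' := - (2 * B / A) - t.
have rootE' : A * t' ^+ 2 + 2 * B * t' + E = 1 by rewrite -[RHS]rootE /t'; field.
have := uniq (x1, x2) (p1 + t' * d1, p2 + t' * d2) => /= /(_ xL xD).
have L' : d1 * (p2 + t' * d2 - p2) - d2 * (p1 + t' * d1 - p1) = 0 by ring.
rewrite onD => /(_ L' rootE') [e1 e2].
have tt' : t = t'.
  have : (t - t') * (d1 ^+ 2 + d2 ^+ 2) = 0.
    transitivity (d1 * (x1 - (p1 + t' * d1)) + d2 * (x2 - (p2 + t' * d2))).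
      by rewrite {1}x1E {1}x2E; ring.
    by rewrite -e1 -e2 !subrr !mulr0 addr0.
  by move/eqP; rewrite mulf_eq0 (negPf d_neq0) orbF subr_eq0 => /eqP.
have tE : A * t = - B.
  have : A * (t + t) = - (2 * B) by rewrite {2}tt' /t'; field.
  lra.
have -> : E = 1 - A * t ^+ 2 - 2 * B * t by rewrite -[X in X - _ - _]rootE; ring.
have -> : B = - (A * t) by rewrite tE opprK.
by ring.
Qed.

(** * Areas in normalized coordinates and their ratio *)

Lemma sum_periodic_shift (F : nat -> R) n h : (forall k, F (k + n)%N = F k) ->
  \sum_(i < n) F (i + h)%N = \sum_(i < n) F i.
Proof.
move=> per; elim: h => [|h IHh]; first by apply: eq_bigr => i _; rewrite addn0.
rewrite -[RHS]IHh; case: n per {IHh} => [|n] per; first by rewrite !big_ord0.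
rewrite big_ord_recr [RHS]big_ord_recl /= add0n addrC; congr (_ + _).
  by rewrite addnS -addSn addnC per.
by apply: eq_bigr => i _; rewrite /bump /= add1n addSn addnS.
Qed.

Section Normalize.
Variables (c : pt R) (w1 w2 w3 : R) (n : nat).

(** Reducing [k] modulo [n] gives an infinite periodic sequence even though [p] is constrained only
    below [n]. *)
Definition normalize (p : nat -> pt R) k := upper w1 w2 w3 (psub (p (k %% n)%N) c).

Lemma normalizeD (p : nat -> pt R) k : normalize p (k + n)%N = normalize p k.
Proof. by rewrite /normalize modnDr. Qed.

Lemma normalize_nxt (p : nat -> pt R) k :
  normalize p k.+1 = upper w1 w2 w3 (psub (p (nxt n (k %% n))) c).
Proof. by rewrite /normalize /nxt -addn1 -modnDml addn1. Qed.

Lemma cross_upper u v : cross (upper w1 w2 w3 u) (upper w1 w2 w3 v) = w1 * w3 * cross u v.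
Proof. by rewrite /cross /upper /=; ring. Qed.

Lemma area_normalize (p : nat -> pt R) :
  w1 * w3 * area n p = 2^-1 * \sum_(i < n) cross (normalize p i) (normalize p i.+1).
Proof.
rewrite /area mulrCA; congr (_ * _); rewrite mulr_sumr.
(* Moving the origin to [c] changes each summand by [g i - g (i + 1)], which cancels around the
   polygon. *)
pose g k := w1 * w3 * cross c (p (k %% n)%N).
have g_shift : \sum_(i < n) g (i + 1)%N = \sum_(i < n) g i.
  by apply: sum_periodic_shift => k; rewrite /g modnDr.
have -> : \sum_(i < n) cross (normalize p i) (normalize p i.+1) =
    \sum_(i < n) (w1 * w3 * cross (p i) (p (nxt n i))) + \sum_(i < n) g i - \sum_(i < n) g (i + 1)%N.
  rewrite -big_split -sumrB; apply: eq_bigr => i _ /=.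
  rewrite normalize_nxt /normalize cross_upper /g addn1 (modn_small (ltn_ord i)) -/(nxt n i).
  by rewrite /cross /psub /=; ring.
by rewrite g_shift addrK.
Qed.

End Normalize.

Lemma area_ratio (n : nat) (C D : ellipse R) (s w1 w2 w3 l1 l2 l3 : R) (p q : nat -> pt R) :
  odd n -> is_ellipse D -> ctr C = ctr D -> s ^+ 2 = 1 ->
  0 < w1 * w3 -> 0 < l1 + l3 -> 0 < l1 * l3 - l2 ^+ 2 -> 0 < (l1 - 1) * (l3 - 1) - l2 ^+ 2 ->
  (forall u v, bil C u v = dot (upper w1 w2 w3 u) (upper w1 w2 w3 v)) ->
  (forall u v, bil D u v = dot (symm l1 l2 l3 (upper w1 w2 w3 u)) (symm l1 l2 l3 (upper w1 w2 w3 v))) ->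
  poncelet_ngon_sense C D n s p -> tangential_polygon C n p q ->
  area n q / area n p = l1 * l3 - l2 ^+ 2.
Proof.
move=> n_odd elD ctrE sqr_s w_gt0 tr_gt0 det_gt0 det1_gt0 bilC bilD pP qT.
have n_gt0 : (0 < n)%N by case: (n) n_odd.
have det_neq0 := lt0r_neq0 det_gt0.
pose P := normalize (ctr C) w1 w2 w3 n p; pose Q := normalize (ctr C) w1 w2 w3 n q.
pose m k := symm_inv l1 l2 l3 (Q k).
have PS k : 0 < s * cross (P k) (P k.+1).
  have [_ _] := pP _ (ltn_pmod k n_gt0).
  by rewrite /P normalize_nxt /normalize cross_upper mulrCA -ctrE => ?; apply: mulr_gt0.
have Punit k : dot (P k) (P k) = 1.
  have [+ _ _] := pP _ (ltn_pmod k n_gt0); by rewrite /on_ellipse /P /normalize -bilC qfE.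
have steps k : half_step l1 l2 l3 s (P k) (m k) /\ half_step l1 l2 l3 s (m k) (P k.+1).
  have kn := ltn_pmod k n_gt0; have [_ /(line_tangent_discr _ _ _ elD) tang _] := pP _ kn.
  have [qk qk'] := qT _ kn.
  apply: tangent_half_steps => //.
  - by rewrite /P /Q /normalize -bilC.
  - by rewrite /P normalize_nxt /Q /normalize -bilC.
  move: tang => /=; rewrite /P normalize_nxt /normalize -ctrE.
  set u := psub (p _) _; set d := psub (p _) (p _); set v := psub (p (nxt _ _)) _.
  have vuE : psub (upper w1 w2 w3 v) (upper w1 w2 w3 u) = upper w1 w2 w3 d.
    by rewrite /v /u /d /upper /psub /=; congr pair; ring.
  rewrite !qfE !bilD -vuE.
  move: (upper _ _ _ u) (upper _ _ _ v) => U V tang.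
  (* With Lagrange's identity, the vanishing discriminant [tang] becomes the distance-1 form of
     tangency. *)
  have Lagrange : dot (symm l1 l2 l3 U) (symm l1 l2 l3 U)
        * dot (symm l1 l2 l3 (psub V U)) (symm l1 l2 l3 (psub V U))
      - dot (symm l1 l2 l3 U) (symm l1 l2 l3 (psub V U)) ^+ 2
      = ((l1 * l3 - l2 ^+ 2) * cross U V) ^+ 2.
    by rewrite /dot /cross /symm /psub /=; ring.
  by rewrite -Lagrange tang; ring.
pose z j := if odd j then m j./2 else P j./2.
have zS j : half_step l1 l2 l3 s (z j) (z j.+1).
  rewrite /z /= uphalf_half; case: (odd j); rewrite ?add1n ?add0n; by case: (steps j./2).
have zper j : z (j + n + n)%N = z j.
  rewrite /z -addnA addnn oddD odd_double addbF halfD odd_double andbF add0n doubleK.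
  by rewrite /m /P /Q !normalizeD.
have shift := half_step_cross_shift _ _ _ _ tr_gt0 det1_gt0 sqr_s z n zS zper.
(* As [n] is odd, index [2i + n] is odd with half [i + n./2], so the shift takes vertices to entries
   of [m]. *)
have mP i : cross (m (i + n./2)%N) (m (i.+1 + n./2)%N) = cross (P i) (P i.+1).
  have := shift i.*2; rewrite -doubleS /z !oddD !odd_double n_odd /= !doubleK.
  by rewrite !halfD !odd_double /= !add0n !doubleK.
have areaPE := area_normalize (ctr C) w1 w2 w3 n p.
have areaQE := area_normalize (ctr C) w1 w2 w3 n q.
have QP : w1 * w3 * area n q = (l1 * l3 - l2 ^+ 2) * (w1 * w3 * area n p).
  rewrite areaPE areaQE mulrCA; congr (_ * _); rewrite mulr_sumr.
  rewrite -(sum_periodic_shift (fun i => cross (Q i) (Q i.+1)) n n./2); last first.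
    by move=> k /=; rewrite -addSn /Q !normalizeD.
  apply: eq_bigr => i _; rewrite -/P -mP -addSn.
  rewrite -(symm_invK l1 l2 l3 det_neq0 (Q (_ + _))) -(symm_invK l1 l2 l3 det_neq0 (Q (i.+1 + _))).
  by rewrite -!/(m _) /cross /symm /=; ring.
(* Seen from the centre, every summand of the area of [P] has the sign [s]. *)
have areaP_neq0 : area n p != 0.
  have : 0 < s * (w1 * w3 * area n p).
    rewrite areaPE -/P mulrCA mulr_sumr; apply: mulr_gt0; first by rewrite invr_gt0.
    case: (n) n_gt0 => // n' _; rewrite big_ord_recl ltr_pwDl //.
    by apply: sumr_ge0 => i _; apply: ltW; apply: PS.
  by apply: contraTneq => ->; rewrite !mulr0 ltxx.
apply: (mulIf areaP_neq0); rewrite divfK //.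
by apply: (mulfI (lt0r_neq0 w_gt0)); rewrite QP mulrCA.
Qed.

End Plane.

Local Open Scope ring_scope.

(* P = p and P' = p' are Poncelet n-gons of the same Poncelet family
   (same pair (C,D), same rotational sense s); Q, Q' their tangential
   polygons.  Then Area(Q)/Area(P) = Area(Q')/Area(P'). *)
Theorem theorem1p3 (R : rcfType) (n : nat) (C D : ellipse R) (s : R)
    (p p' q q' : nat -> pt R) :
  odd n ->
  is_ellipse C -> is_ellipse D ->
  ctr C = ctr D ->
  (forall x, on_ellipse D x -> strictly_inside C x) ->
  (s = 1 \/ s = -1) ->
  poncelet_ngon_sense C D n s p ->
  poncelet_ngon_sense C D n s p' ->
  tangential_polygon C n p q ->
  tangential_polygon C n p' q' ->
  area n q / area n p = area n q' / area n p'.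
Proof.
move=> n_odd elC elD ctrE inside s_sign pP pP' qT qT'.
have inside0 v : qf D v = 1 -> qf C v < 1.
  case: v => v1 v2 vD.
  have E : psub (v1 + (ctr D).1, v2 + (ctr D).2) (ctr D) = (v1, v2) by rewrite /psub /= !addrK.
  by have := inside (v1 + (ctr D).1, v2 + (ctr D).2); rewrite /on_ellipse /strictly_inside ctrE E; apply.
have sqr_s : s ^+ 2 = 1 by case: s_sign => ->; rewrite ?sqrrN expr1n.
(* The normal form depends on [C] and [D] only, so both ratios equal the same [det L]. *)
have [w1 [w2 [w3 [l1 [l2 [l3 [[w_gt0 tr_gt0 det_gt0 det1_gt0] [bilC bilD]]]]]]]] :=
  normal_form _ _ _ elC elD inside0.
by rewrite !(area_ratio _ _ _ _ _ _ _ _ _ _ _ _ _ n_odd elD ctrE sqr_s w_gt0 tr_gt0 det_gt0 det1_gt0 bilC bilD).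
Qed.
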